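(* Let $\sigma\colon(\mathcal M,L)\to(\mathcal B,\tilde L)$ be a pseudo-Finsler submersion such that for every $v\in\mathcal A$ the vertical space at $\pi(v)$ is $g_v$-non-degenerate. For each admissible $v$, vertical $w$ and $g_v$-horizontal $x$ at $p$, $$(\dot\partial w^\top)_v=(\dot\partial w^\bot)_v=0,\qquad(\dot\partial x^\top)_v=2C^\sharp_v(x,\cdot)^\top_v,\qquad(\dot\partial x^\bot)_v=-2C^\sharp_v(x,\cdot)^\top_v.$$ That is to say, for an arbitrary vector $e$ at $p$, $$(\dot\partial e^\top)_v=2C^\sharp_v(e^\bot_v,\cdot)^\top_v,\qquad(\dot\partial e^\bot)_v=-2C^\sharp_v(e^\bot_v,\cdot)^\top_v.$$
   Context: A pseudo-Finsler metric on $\mathcal M$ (with projection $\pi\colon T\mathcal M\to\mathcal M$) is a smooth $L\colon\mathcal A\to\mathbb R$, $\mathcal A\subset T\mathcal M\setminus\mathbf 0$ open and invariant under positive scalar multiplication, with $L(\lambda v)=\lambda^2L(v)$ for $\lambda>0$ and with non-degenerate fundamental tensor $g_v(e,h)=\frac12\frac{\partial^2}{\partial s\partial t}L(v+se+th)|_{s=t=0}$ for every $v\in\mathcal A$ (elements of $\mathcal A$ are called admissible; $\mathcal A_p=\mathcal A\cap T_p\mathcal M$). Cartan tensor: $C_v(b,e,h)=\frac14\frac{\partial^3}{\partial r\partial s\partial t}L(v+rb+se+th)|_{r=s=t=0}$; $C^\sharp_v$ is defined by $g_v(b,C^\sharp_v(e,h))=C_v(b,e,h)$. Let $\sigma\colon\mathcal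 M\to\mathcal B$ be a surjective map with surjective differential; vertical vectors at $p$ are the elements of $\mathcal V_p=\ker d\sigma_p$. An admissible $v\in T_p\mathcal M$ is horizontal if $g_v(v,w)=0$ for all $w\in\mathcal V_p$; a vector is $g_v$-horizontal if it is $g_v$-orthogonal to $\mathcal V_p$. $\sigma\colon(\mathcal M,L)\to(\mathcal B,\tilde L)$ is a pseudo-Finsler submersion if the restriction of $L$ to the tangent spaces of the fibers is a pseudo-Finsler metric on each fiber, and $L(v)=\tilde L(d\sigma(v))$ for every horizontal $v$. For $v\in\mathcal A_p$ and $e\in T_p\mathcal M$ write $e=e^\top_v+e^\bot_v$ with $e^\top_v\in\mathcal V_p$ and $e^\bot_v$ $g_v$-horizontal. For fixed $e$, $e^\top$ and $e^\bot$ denote the smooth maps $\mathcal A_p\to T_p\mathcal M$, $v\mapsto e^\top_v$ and $v\mapsto e^\bot_v$, and $(\dot\partial e^\top)_v(h)=\frac{d}{dt}e^\top_{v+th}|_{t=0}$, similarly $(\dot\partial e^\bot)_v(h)$, for $h\in T_p\mathcal M$. *)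

(* Defs.v *)
From HB Require Import structures.
From mathcomp Require Import all_boot all_order all_algebra.
From mathcomp Require Import all_classical all_reals all_analysis.

Set Implicit Arguments.
Unset Strict Implicit.
Unset Printing Implicit Defensive.

Import Order.TTheory GRing.Theory Num.Theory.
Import numFieldNormedType.Exports.

Local Open Scope classical_set_scope.
Local Open Scope ring_scope.

(* Meant for U open and V, W finite-dimensional, where this recursion is
   equivalent to the usual C^k. *)
Fixpoint Ck_on (R : realType) (V W : normedModType R) (k : nat) (U : set V)
    (f : V -> W) : Prop :=
  if k is k'.+1 then
    (forall x, U x -> differentiable f x) /\
    (forall v, Ck_on k' U (fun x => 'd f x v))
  else forall x, U x -> {for x, continuous f}.

Definition smooth_on (R : realType) (V W : normedModType R) (U : set V)
  (f : V -> W) : Prop := forall k, Ck_on k U f.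

(* [coord] only matters on [dom], and [para] (the inverse of [coord]) only on
   the image [coord @` dom]. *)
Record chart (R : realType) (n : nat) (T : topologicalType) := Chart {
  dom : set T;
  coord : T -> 'rV[R]_n;
  para : 'rV[R]_n -> T;
  dom_open : open dom;
  img_open : open (coord @` dom);
  coordK : forall p, dom p -> para (coord p) = p;
  coord_cont : forall p, dom p -> {for p, continuous coord};
  para_cont : forall x, (coord @` dom) x -> {for x, continuous para} }.

(* [chart_at] is a preferred chart around each point; it is only used to give
   a concrete model of the tangent spaces, see [tangent]. *)
Record manifold (R : realType) (n : nat) := Manifold {
  mcarrier :> topologicalType;
  mhausdorff : hausdorff_space mcarrier;
  msecond_countable : @second_countable mcarrier;
  atlas : set (chart R n mcarrier);
  chart_at : mcarrier -> chart R n mcarrier;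
  chart_at_atlas : forall p, atlas (chart_at p);
  chart_at_dom : forall p, dom (chart_at p) p;
  atlas_compat : forall c d, atlas c -> atlas d ->
    smooth_on (coord c @` (dom c `&` dom d)) (coord d \o para c) }.

Definition smooth_map (R : realType) (n m : nat) (M : manifold R n)
    (N : manifold R m) (f : M -> N) : Prop :=
  continuous f /\
  forall c d, atlas c -> atlas d ->
    smooth_on (coord c @` (dom c `&` f @^-1` dom d)) (coord d \o f \o para c).

(* T_p M: a tangent vector at p is represented by its components in the
   preferred chart at p. *)
Definition tangent (R : realType) (n : nat) (M : manifold R n) (p : M) :
  normedModType R := 'rV[R]_n.

(* The differential T_p M -> T_{f p} N. *)
Definition dmap (R : realType) (n m : nat) (M : manifold R n)
    (N : manifold R m) (f : M -> N) (p : M) : tangent p -> tangent (f p) :=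
  'd (coord (chart_at (f p)) \o f \o para (chart_at p)) (coord (chart_at p) p).
Arguments dmap {R n m M N} f p _.

(* The tangent vector at [para c x] whose components in the chart [c] are
   [xi], i.e. sum_i xi_i d/dx^i. The map (x, xi) |-> (para c x, tvec c x xi)
   is thus the parametrization of TM induced by [c]. *)
Definition tvec (R : realType) (n : nat) (M : manifold R n)
    (c : chart R n M) (x xi : 'rV[R]_n) : tangent (para c x) :=
  'd (coord (chart_at (para c x)) \o para c) x xi.

(* The trace of A, a subset of TM, in the chart of TM induced by [c]. *)
Definition tdom (R : realType) (n : nat) (M : manifold R n)
    (A : forall p : M, set (tangent p)) (c : chart R n M) :
    set ('rV[R]_n * 'rV[R]_n)%type :=
  [set z | (coord c @` dom c) z.1 /\ A (para c z.1) (tvec c z.1 z.2)].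

Definition open_in_TM (R : realType) (n : nat) (M : manifold R n)
    (A : forall p : M, set (tangent p)) : Prop :=
  forall c, atlas c -> open (tdom A c).

Definition smooth_on_TM (R : realType) (n : nat) (M : manifold R n)
    (A : forall p : M, set (tangent p)) (L : forall p : M, tangent p -> R) :
    Prop :=
  forall c, atlas c ->
    smooth_on (tdom A c) (fun z => L (para c z.1) (tvec c z.1 z.2)).

Section Tensors.
Variables (R : realType) (V : normedModType R) (f : V -> R) (v : V).

(* f stands for the restriction of L to T_p M. *)
Definition fund_tensor (e h : V) : R :=
  2^-1 * derive1 (fun s : R =>
    derive1 (fun t : R => f (v + s *: e + t *: h)) 0) 0.

Definition cartan_tensor (b e h : V) : R :=
  4^-1 * derive1 (fun r : R => derive1 (fun s : R =>
    derive1 (fun t : R => f (v + r *: b + s *: e + t *: h)) 0) 0) 0.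

(* The vector y such that g_v(b, y) = C_v(b, e, h) for all b; it exists and
   is unique when g_v is non-degenerate (and the dimension is finite). *)
Definition cartan_sharp (e h : V) : V :=
  xget 0 [set y | forall b, fund_tensor b y = cartan_tensor b e h].

Definition nondegenerate_on (W : set V) : Prop :=
  forall e, W e -> (forall h, W h -> fund_tensor e h = 0) -> e = 0.

Definition g_horizontal (W : set V) : set V :=
  [set x | forall w, W w -> fund_tensor x w = 0].

(* The component in W of the decomposition e = e^T + e^bot, with e^T in W
   and e^bot g_v-horizontal; it exists and is unique when W is g_v-non-
   degenerate. *)
Definition vpart (W : set V) (e : V) : V :=
  xget 0 [set y | W y /\ g_horizontal W (e - y)].

Definition hpart (W : set V) (e : V) : V := e - vpart W e.

End Tensors.

Record pseudo_finsler (R : realType) (n : nat) (M : manifold R n)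
    (A : forall p : M, set (tangent p)) (L : forall p : M, tangent p -> R) :
    Prop := PseudoFinsler {
  pf_open : open_in_TM A;
  pf_neq0 : forall p v, A p v -> v != 0;
  pf_cone : forall p v (l : R), 0 < l -> A p v -> A p (l *: v);
  pf_smooth : smooth_on_TM A L;
  pf_homog : forall p v (l : R), 0 < l -> A p v -> L p (l *: v) = l ^+ 2 * L p v;
  pf_nondeg : forall p v, A p v -> nondegenerate_on (L p) v setT }.

Record embedding (R : realType) (n m : nat) (N : manifold R n)
    (M : manifold R m) (i : N -> M) : Prop := Embedding {
  emb_smooth : smooth_map i;
  emb_inj : injective i;
  emb_immersion : forall q, injective (dmap i q);
  emb_topology : forall U : set N, open U ->
    exists2 O : set M, open O & U = i @^-1` O }.

Definition vertical (R : realType) (n m : nat) (M : manifold R n)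
    (B : manifold R m) (sigma : M -> B) (p : M) : set (tangent p) :=
  [set w | dmap sigma p w = 0].
Arguments vertical {R n m M B} sigma p.

(* [ps_fibers]: the fiber over b is handled through any embedding
   i : F -> M with image sigma^{-1}(b); there is one by the regular value
   theorem, unique up to diffeomorphism. The restriction of L to TF is the
   pullback of L by di, with domain the preimage of A. *)
Record pseudo_finsler_submersion (R : realType) (n m : nat)
    (M : manifold R n) (A : forall p : M, set (tangent p))
    (L : forall p : M, tangent p -> R)
    (B : manifold R m) (A' : forall q : B, set (tangent q))
    (L' : forall q : B, tangent q -> R) (sigma : M -> B) : Prop :=
  PseudoFinslerSubmersion {
  ps_smooth : smooth_map sigma;
  ps_surj : forall q : B, exists p : M, sigma p = q;
  ps_dsurj : forall (p : M) (u : tangent (sigma p)),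
    exists v : tangent p, dmap sigma p v = u;
  ps_fibers : forall (b : B) (k : nat) (F : manifold R k) (i : F -> M),
    embedding i -> range i = sigma @^-1` [set b] ->
    pseudo_finsler (fun q (u : tangent q) => A (i q) (dmap i q u))
                   (fun q (u : tangent q) => L (i q) (dmap i q u));
  ps_isometry : forall (p : M) (v : tangent p),
    A p v -> g_horizontal (L p) v (vertical sigma p) v ->
    A' (sigma p) (dmap sigma p v) /\
    L p v = L' (sigma p) (dmap sigma p v) }.

(* Main.v *)
Require Import Defs.
From HB Require Import structures.
From mathcomp Require Import all_boot all_order all_algebra.
From mathcomp Require Import all_classical all_reals all_analysis.
From mathcomp Require Import perm ring.

Set Implicit Arguments.
Unset Strict Implicit.
Unset Printing Implicit Defensive.

Import Order.TTheory GRing.Theory Num.Theory.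
Import numFieldNormedType.Exports.

Local Open Scope classical_set_scope.
Local Open Scope ring_scope.

(* Write G(u) for the Gram matrix of g_u. If the rows of K form a basis of the
   vertical space, the vertical projection at u is e |-> c(u) K with
   c(u) = e G(u) K^T (K G(u) K^T)^-1, which is differentiable in u. Deriving
   c(u) (K G(u) K^T) = e G(u) K^T along h gives c' = x G' K^T (K G K^T)^-1, where
   x is the horizontal part of e and x G' b^T = 2 C_v(h, x, b). Third derivatives
   being symmetric, this is 2 g_v(b, C^#_v(x, h)), so c' K is twice the vertical
   part of C^#_v(x, h). *)

(** * The tensors as iterated directional derivatives *)

(** Both sides are the limit of one and the same difference quotient. This turns the one-variable
    derivatives in the definitions of the tensors into directional derivatives. *)
Lemma derive1_line (R : realType) (V W : normedModType R) (g : V -> W)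
    (x h : V) :
  derive1 (fun t : R => g (x + t *: h)) 0 = 'D_h g x.
Proof.
rewrite /derive1 /derive; set d := (X in X @ _).
set d' := (X in _ = lim (X @ _)).
suff -> : d = d' by []; apply/funext => t.
by rewrite /d /d' /= addr0 scale0r addr0 [x + _]addrC.
Qed.

Lemma fund_tensorE (R : realType) (V : normedModType R) (f : V -> R)
    (v e h : V) :
  fund_tensor f v e h = 2^-1 * 'D_e ('D_h f) v.
Proof.
rewrite /fund_tensor -(derive1_line ('D_h f) v e).
suff -> : (fun s : R => derive1 (fun t : R => f (v + s *: e + t *: h)) 0) =
  (fun s => 'D_h f (v + s *: e)) by [].
by apply/funext => s; exact: (derive1_line f).
Qed.

Lemma cartan_tensorE (R : realType) (V : normedModType R) (f : V -> R)
    (v b e h : V) :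
  cartan_tensor f v b e h = 4^-1 * 'D_b ('D_e ('D_h f)) v.
Proof.
rewrite /cartan_tensor -(derive1_line ('D_e ('D_h f)) v b).
suff -> : (fun r : R => derive1 (fun s : R =>
    derive1 (fun t : R => f (v + r *: b + s *: e + t *: h)) 0) 0) =
  (fun r => 'D_e ('D_h f) (v + r *: b)) by [].
apply/funext => r; rewrite -(derive1_line ('D_h f) (v + r *: b) e).
suff -> : (fun s : R =>
    derive1 (fun t : R => f (v + r *: b + s *: e + t *: h)) 0) =
  (fun s => 'D_h f (v + r *: b + s *: e)) by [].
by apply/funext => s; exact: (derive1_line f).
Qed.

(** * Locality of the differential, and C^k functions on open sets and on slices *)

(** The first-order expansion of [f] at [x] is also one of [g], and the continuous linear part of
    such an expansion is unique. *)
Lemma near_eq_is_diff (R : realType) (V W : normedModType R) (f g : V -> W)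
    (x : V) :
  {near x, f =1 g} -> differentiable f x -> is_diff x g ('d f x).
Proof.
move=> fg df.
have dg : g \o shift x = cst (g x) + 'd f x +o_ 0 id.
  apply/eqaddoP => _/posnumP[e].
  have /diff_locally/eqaddoP/(_ e%:num (ltac:(by []))) := df.
  move=> hf; have fgx := nbhs_singleton fg.
  have : \forall y \near 0, f (y + x) = g (y + x).
    move: fg; rewrite (near_shift 0 x) /=.
    by apply: filterS => y /=; rewrite subr0.
  apply: filterS2 hf => y /= + fgy.
  by rewrite !fctE /= fgx fgy.
have dgE := diff_unique (diff_continuous df) dg.
apply: DiffDef => //; apply/diff_locallyP; rewrite dgE.
by split; [exact: diff_continuous|].
Qed.

(** Since [U] is open, the differentials agree on [U] as well, which carries the induction. It is
    needed because ['d f x h] and ['D_h f x] are identified only where [f] is differentiable. *)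
Lemma Ck_on_eq (R : realType) (V W : normedModType R) (k : nat) (U : set V)
    (f g : V -> W) :
  open U -> (forall x, U x -> f x = g x) -> Ck_on k U f -> Ck_on k U g.
Proof.
move=> oU; elim: k f g => [|k IH] f g fg /= => [cf x Ux|[df cf]].
  have cfx : f @ x --> f x := cf x Ux.
  suff : g @ x --> g x by [].
  rewrite -(fg _ Ux); apply: cvg_trans cfx.
  apply: near_eq_cvg; near=> y; apply: fg; near: y.
  exact: open_nbhs_nbhs.
have dg x : U x -> is_diff x g ('d f x).
  move=> Ux; apply: near_eq_is_diff (df _ Ux).
  by near=> y; apply: fg; near: y; exact: open_nbhs_nbhs.
split=> [x Ux|v]; first by have [] := dg x Ux.
by apply: IH (cf v) => x Ux; have [_ ->] := dg x Ux.
Unshelve. all: by end_near. Qed.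

Lemma Ck_on_derive (R : realType) (V W : normedModType R) (k : nat) (U : set V)
    (f : V -> W) (h : V) :
  open U -> Ck_on k.+1 U f -> Ck_on k U ('D_h f).
Proof.
move=> oU [df cf]; apply: Ck_on_eq (cf h) => // x Ux.
by rewrite deriveE//; exact: df.
Qed.

Lemma is_diff_pairr (R : realType) (V1 V2 : normedModType R) (x : V1) (y : V2) :
  is_diff y (fun z : V2 => (x, z)) (fun z => (0, z)).
Proof. exact: (is_diff_pair (is_diff_cst x y) (is_diff_id y)). Qed.

Lemma open_slice (R : realType) (V1 V2 : normedModType R) (U : set (V1 * V2))
    (x : V1) :
  open U -> open [set y | U (x, y)].
Proof.
move=> oU; apply: (open_comp _ oU) => y _.
by apply: differentiable_continuous; have [] := is_diff_pairr x y.
Qed.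

(** Serves to pass from regularity of L on the tangent bundle to regularity on one tangent space.
    The slice has as derivative along [v] the derivative of [F] along [(0, v)], again a slice, so
    induction applies. *)
Lemma Ck_on_slice (R : realType) (V1 V2 W : normedModType R) (k : nat)
    (U : set (V1 * V2)) (F : V1 * V2 -> W) (x : V1) :
  open U -> Ck_on k U F ->
  Ck_on k [set y | U (x, y)] (fun y => F (x, y)).
Proof.
move=> oU; have oU' := open_slice x oU.
elim: k F => [|k IH] F /= => [cF y Uy|[dF cF]].
  apply: (@continuous_comp _ _ _ (fun y : V2 => (x, y)) F); last exact: cF.
  by apply: differentiable_continuous; have [] := is_diff_pairr x y.
split=> [y Uy|v].
  apply: (@differentiable_comp _ _ _ _ (fun y : V2 => (x, y)) F).
    by have [] := is_diff_pairr x y.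
  exact: dF.
apply: Ck_on_eq (IH _ (cF (0, v))) => // y Uy.
have [dy Ey] := is_diff_pairr x y.
by rewrite (@diff_comp _ _ _ _ (fun y : V2 => (x, y)) F) //= ?Ey//; exact: dF.
Qed.

(** * Symmetry of second directional derivatives *)

Lemma is_derive_line (R : realType) (V W : normedModType R) (f : V -> W)
    (x a : V) (s : R) :
  differentiable f (x + s *: a) ->
  is_derive s 1 (fun r : R => f (x + r *: a)) ('D_a f (x + s *: a)).
Proof.
move=> df.
have dl : is_diff s ((cst x : R -> V) + ( *:%R^~ a)) (0 + ( *:%R^~ a)).
  by apply: is_diffD.
have ldf : is_diff s (fun r : R => x + r *: a) (fun r => 0 + r *: a).
  exact: dl.
have dfl : is_diff (x + s *: a) f ('d f (x + s *: a)) by exact: DiffDef.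
have [dc Ec] := is_diff_comp ldf dfl.
apply: DeriveDef; first exact: diff_derivable.
by rewrite deriveE // Ec /= add0r scale1r deriveE.
Qed.

(* By the mean value theorem in s, f(x+sa+tb) - f(x+sa) varies over [0, t] by
   t (D_a f(x+ca+tb) - D_a f(x+ca)), and D_a f is differentiable at x. *)
Lemma second_difference (R : realType) (V : normedModType R) (f : V -> R)
    (x a b : V) :
  (\forall y \near x, differentiable f y) -> differentiable ('D_a f) x ->
  forall e : R, 0 < e -> exists2 d : R, 0 < d & forall t : R, 0 < t < d ->
    `|f (x + t *: a + t *: b) - f (x + t *: a) - f (x + t *: b) + f x
       - t ^+ 2 * 'D_b ('D_a f) x| <= e * t ^+ 2.
Proof.
move=> df dg e e0; set g := 'D_a f.
(* [t * N] bounds the norm of c a + u b for c and u in [0, t]; the summand 1 keeps [N] positive when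
   a = b = 0. *)
pose N := `|a| + `|b| + 1.
have N0 : 0 < N by rewrite ltr_wpDl// addr_ge0.
(* With this precision each first-order remainder of [g] is at most e t / 2; there are two of them,
   and the mean value theorem contributes one more factor t. *)
have e'0 : 0 < e / (2 * N) by rewrite divr_gt0// mulr_gt0.
have /diff_locally/eqaddoP/(_ _ e'0) dgx := dg.
have df' : \forall y \near 0, differentiable f (y + x).
  move: df; rewrite (near_shift 0 x) /=.
  by apply: filterS => y /=; rewrite subr0.
have /nbhs_ballP[r /= r0 H] : \forall y \near (0 : V),
    differentiable f (y + x) /\
    `|g (y + x) - g x - 'd g x y| <= e / (2 * N) * `|y|.
  by apply: filterS2 df' dgx => y dfy /=; rewrite !fctE /= opprD addrA.
exists (r / N); first exact: divr_gt0.
move=> t /andP[t0 tr].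
have rtN : t * N < r by rewrite -ltr_pdivlMr.
have inr c u : 0 <= c <= t -> 0 <= u <= t -> `|c *: a + u *: b| <= t * N.
  move=> /andP[c0 ct] /andP[u0 ut].
  rewrite (le_trans (ler_normD _ _))// !normrZ !ger0_norm//.
  rewrite /N 2!mulrDr -addrA lerD// ?ler_wpM2r//.
  rewrite -[leLHS]addr0 lerD ?ler_wpM2r//.
  by rewrite mulr1 ltW.
have Hb c u : 0 <= c <= t -> 0 <= u <= t ->
    differentiable f (x + c *: a + u *: b) /\
    `|g (x + c *: a + u *: b) - g x - 'd g x (c *: a + u *: b)|
      <= e / (2 * N) * (t * N).
  move=> hc hu; have := H (c *: a + u *: b).
  rewrite -ball_normE /= sub0r normrN => /(_ (le_lt_trans (inr _ _ hc hu) rtN)).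
  rewrite addrC addrA => -[? Hle]; split=> //; apply: (le_trans Hle).
  by apply: ler_wpM2l; [exact: ltW|exact: inr].
have tt : 0 <= t <= t by rewrite lexx ltW.
have t00 : (0 : R) <= 0 <= t by rewrite lexx ltW.
pose phi s := f (x + t *: b + s *: a) - f (x + s *: a).
have dphi s : 0 <= s <= t ->
    is_derive s 1 phi (g (x + s *: a + t *: b) - g (x + s *: a)).
  move=> hs; have [d1 _] := Hb s t hs tt; have [d2 _] := Hb s 0 hs t00.
  rewrite scale0r addr0 in d2; rewrite addrAC in d1 *.
  exact: (is_deriveB (is_derive_line d1) (is_derive_line d2)).
have [||c] :=
  @MVT R phi (fun s => g (x + s *: a + t *: b) - g (x + s *: a)) 0 t t0.
- by move=> s; rewrite in_itv /= => /andP[s0 st]; apply: dphi; rewrite !ltW.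
- apply: derivable_within_continuous => s; rewrite in_itv /= => hs.
  by have [] := dphi s hs.
rewrite in_itv /= => /andP[c0 ct]; rewrite /phi scale0r !addr0 subr0.
rewrite [x + t *: b + t *: a]addrAC => phiE.
have hc : 0 <= c <= t by rewrite !ltW.
have [_ B1] := Hb c t hc tt; have [_ B2] := Hb c 0 hc t00.
rewrite !scale0r !addr0 in B2.
have -> : f (x + t *: a + t *: b) - f (x + t *: a) - f (x + t *: b) + f x =
  (g (x + c *: a + t *: b) - g (x + c *: a)) * t by rewrite -phiE; ring.
have dZ u w : 'd g x (u *: w) = u * 'd g x w by rewrite linearZ.
move: B1 B2; rewrite deriveE// linearD !dZ.
set G1 := g _; set G2 := g (x + c *: a); set da := 'd g x a; set D := 'd g x b.
have -> : e / (2 * N) * (t * N) = e * t / 2 by field; rewrite gt_eqF.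
move=> B1 B2.
(* Expanding both values of [g] at [x], the terms [g x] and [c * da] cancel; what remains beside
   [t * D] is the difference of the two remainders. *)
have -> : (G1 - G2) * t - t ^+ 2 * D =
  ((G1 - g x - (c * da + t * D)) - (G2 - g x - c * da)) * t by ring.
rewrite normrM [`|t|]gtr0_norm// expr2 mulrA ler_pM2r//.
by rewrite (le_trans (ler_normB _ _))// [leRHS](splitr (e * t)) lerD.
Qed.

(** Young's form of the theorem: the second difference is symmetric in [a] and [b], and for small t
    its quotient by t^2 is within e / 2 of either mixed derivative. *)
Lemma derive_sym (R : realType) (V : normedModType R) (f : V -> R) (x a b : V) :
  (\forall y \near x, differentiable f y) ->
  differentiable ('D_a f) x -> differentiable ('D_b f) x ->
  'D_b ('D_a f) x = 'D_a ('D_b f) x.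
Proof.
move=> df da db; apply/eqP; rewrite -subr_eq0 -normr_le0.
apply/ler_addgt0Pl => e e0.
have e20 : 0 < e / 2 by rewrite divr_gt0.
have [d1 d10 H1] := second_difference b df da e20.
have [d2 d20 H2] := second_difference a df db e20.
rewrite addr0; pose t := Num.min d1 d2 / 2.
have m0 : 0 < Num.min d1 d2 by rewrite lt_min d10.
have t0 : 0 < t by rewrite divr_gt0.
have tm : t < Num.min d1 d2 by rewrite ltr_pdivrMr// ltr_pMr// ltr1n.
move: tm; rewrite lt_min => /andP[td1 td2].
have := H2 t; have := H1 t; rewrite t0 td1 td2 => /(_ isT) B1 /(_ isT).
rewrite [x + t *: b + t *: a]addrAC => B2.
rewrite -(@ler_pM2l _ (t ^+ 2)) ?exprn_gt0//.
rewrite -[X in X * `|_|]gtr0_norm ?exprn_gt0// -normrM.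
set Db := 'D_b _ x in B1 *; set Da := 'D_a ('D_b _) x in B2 *.
set F := f (x + t *: a + t *: b) in B1 B2.
set Fa := f (x + t *: a) in B1 B2; set Fb := f (x + t *: b) in B1 B2.
have -> : t ^+ 2 * (Db - Da) = (F - Fb - Fa + f x - t ^+ 2 * Da) -
  (F - Fa - Fb + f x - t ^+ 2 * Db) by ring.
apply: (le_trans (ler_normB _ _)).
have -> : t ^+ 2 * e = e / 2 * t ^+ 2 + e / 2 * t ^+ 2 by field.
exact: (lerD B2 B1).
Qed.

(** * Derivatives of matrix-valued functions *)

Section MatrixDerive.
Variables (R : realType) (V : normedModType R) (v h : V).

Lemma is_derive_mxP (m n : nat) (M : V -> 'M[R]_(m, n)) (dM : 'M[R]_(m, n)) :
  is_derive v h M dM <->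
  forall i j, is_derive v h (fun u => M u i j) (dM i j).
Proof.
split=> [[dMv <-] i j|H].
  have dv := (derivable_mxP _ _ _).1 dMv i j.
  by apply: DeriveDef => //; rewrite derive_mx// mxE.
have dMv : derivable M v h by apply/derivable_mxP => i j; have [] := H i j.
apply: DeriveDef => //; apply/matrixP => i j; rewrite derive_mx// mxE.
by have [] := H i j.
Qed.

Lemma is_derive_bigsum (I : Type) (r : seq I) (F : I -> V -> R) (dF : I -> R) :
  (forall i, is_derive v h (F i) (dF i)) ->
  is_derive v h (fun u => \sum_(i <- r) F i u) (\sum_(i <- r) dF i).
Proof.
move=> H; elim: r => [|i r IH].
  rewrite big_nil (_ : (fun _ => _) = cst 0); first exact: is_derive_cst.
  by apply/funext => u; rewrite big_nil.
rewrite big_cons (_ : (fun _ => _) = F i + (fun u => \sum_(j <- r) F j u)).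
  exact: is_deriveD.
by apply/funext => u; rewrite big_cons.
Qed.

Lemma derivable_bigprod (I : Type) (r : seq I) (F : I -> V -> R) :
  (forall i, derivable (F i) v h) ->
  derivable (fun u => \prod_(i <- r) F i u) v h.
Proof.
move=> H; elim: r => [|i r IH].
  rewrite (_ : (fun _ => _) = cst 1); first exact: derivable_cst.
  by apply/funext => u; rewrite big_nil.
rewrite (_ : (fun _ => _) = F i * (fun u => \prod_(j <- r) F j u)).
  exact: derivableM.
by apply/funext => u; rewrite big_cons.
Qed.

Lemma is_derive_mulmx (m n k : nat) (M : V -> 'M[R]_(m, n))
    (N : V -> 'M[R]_(n, k)) (dM : 'M[R]_(m, n)) (dN : 'M[R]_(n, k)) :
  is_derive v h M dM -> is_derive v h N dN ->
  is_derive v h (fun u => M u *m N u) (dM *m N v + M v *m dN).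
Proof.
move=> /is_derive_mxP dMv /is_derive_mxP dNv; apply/is_derive_mxP => i j.
rewrite (_ : (fun _ => _) = fun u => \sum_l M u i l * N u l j); last first.
  by apply/funext => u; rewrite mxE.
rewrite !mxE -big_split /=; apply: is_derive_bigsum => l.
have := is_deriveM (dMv i l) (dNv l j).
by rewrite addrC [N v l j *: _]mulrC.
Qed.

Lemma is_derive_mulmxl (m n k : nat) (A : 'M[R]_(m, n)) (N : V -> 'M[R]_(n, k))
    (dN : 'M[R]_(n, k)) :
  is_derive v h N dN -> is_derive v h (fun u => A *m N u) (A *m dN).
Proof.
move=> dNv; have -> : A *m dN = 0 *m N v + A *m dN by rewrite mul0mx add0r.
by apply: (@is_derive_mulmx _ _ _ (cst A)) => //; exact: is_derive_cst.
Qed.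

Lemma is_derive_mulmxr (m n k : nat) (B : 'M[R]_(n, k)) (M : V -> 'M[R]_(m, n))
    (dM : 'M[R]_(m, n)) :
  is_derive v h M dM -> is_derive v h (fun u => M u *m B) (dM *m B).
Proof.
move=> dMv; have -> : dM *m B = dM *m B + M v *m 0 by rewrite mulmx0 addr0.
by apply: (@is_derive_mulmx _ _ _ _ (cst B)) => //; exact: is_derive_cst.
Qed.

Lemma derivable_det (n : nat) (M : V -> 'M[R]_n) :
  (forall i j, derivable (fun u => M u i j) v h) ->
  derivable (fun u => \det (M u)) v h.
Proof.
move=> H; have dp (s : 'S_n) :
    derivable (fun u => (-1) ^+ s * \prod_i M u i (s i)) v h.
  by apply: (@derivableM _ _ (cst _)) => //; exact: derivable_bigprod.
by have [] := is_derive_bigsum (index_enum 'S_n) (fun s => derivableP (dp s)).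
Qed.

(** By Cramer's rule the inverse is the adjugate divided by the determinant, and both are polynomial
    in the entries. *)
Lemma derivable_invmx (n : nat) (M : V -> 'M[R]_n) :
  derivable M v h -> (\forall u \near v, M u \in unitmx) ->
  derivable (fun u => invmx (M u)) v h.
Proof.
move=> /derivable_mxP dM uM.
(* On a singular matrix [invmx] returns the matrix itself, so the adjugate formula is available only
   near [v]. *)
apply: (@near_eq_derivable _ _ _ (fun u => (\det (M u))^-1 *: \adj (M u))).
  by apply: filterS uM => u uu; rewrite /invmx uu.
apply/derivable_mxP => i j.
rewrite (_ : (fun u => _ i j) =
  (fun u => (\det (M u))^-1) * (fun u => \adj (M u) i j)); last first.
  by apply/funext => u; rewrite ?fctE !mxE.
apply: derivableM.
  apply: derivableV; last exact: derivable_det.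
  by have := nbhs_singleton uM; rewrite unitmxE unitfE.
rewrite (_ : (fun _ => _) =
    cst ((-1) ^+ (j + i)) * (fun u => \det (row' j (col' i (M u)))));
  last first.
  by apply/funext => u; rewrite ?fctE !mxE.
apply: derivableM => //; apply: derivable_det => k l.
rewrite (_ : (fun _ => _) = fun u => M u (lift j k) (lift i l)) //.
by apply/funext => u; rewrite ?fctE !mxE.
Qed.

End MatrixDerive.

(** * Linear and bilinear forms in coordinates *)

(** Linearity is a plain hypothesis, not a structure on [phi], because [fund_tensor f u] is shown to
    be linear only for [u] in [U]. *)
Lemma linear_row_sum (R : pzRingType) (n : nat) (phi : 'rV[R]_n -> R)
    (x : 'rV[R]_n) :
  (forall a y z, phi (a *: y + z) = a * phi y + phi z) ->
  phi x = \sum_i x 0 i * phi (delta_mx 0 i).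
Proof.
move=> lin.
have phi0 : phi 0 = 0.
  apply: (addrI (phi 0)).
  by rewrite addr0 -{1}(mul1r (phi 0)) -lin scale1r addr0.
rewrite {1}(row_sum_delta x).
elim/big_rec2 : _ => [|i u w _ IH]; first exact: phi0.
by rewrite lin IH.
Qed.

Lemma bilinear_mxE (R : pzRingType) (n : nat) (g : 'rV[R]_n -> 'rV[R]_n -> R)
    (x y : 'rV[R]_n) :
  (forall a x y z, g (a *: x + y) z = a * g x z + g y z) ->
  (forall a x y z, g z (a *: x + y) = a * g z x + g z y) ->
  g x y =
    \sum_i x 0 i * \sum_j y 0 j * g (delta_mx 0 i) (delta_mx 0 j).
Proof.
move=> linl linr.
rewrite (linear_row_sum (phi := g ^~ y) x) => [|a u w]; last exact: linl.
by apply: eq_bigr => i _; rewrite (linear_row_sum (phi := g _) y).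
Qed.

(** * Symmetries of the fundamental and Cartan tensors of a C^3 function *)

Section Hessian.
Variables (R : realType) (V : normedModType R) (U : set V) (f : V -> R).
Hypotheses (oU : open U) (C3 : Ck_on 3 U f).

Let near_U u : U u -> \forall y \near u, U y.
Proof. by move=> Uu; exact: open_nbhs_nbhs. Qed.

Lemma C3_diff u : U u -> differentiable f u.
Proof. by case: C3 => + _; apply. Qed.

Lemma C3_diff_derive a u : U u -> differentiable ('D_a f) u.
Proof. by have [+ _] := Ck_on_derive a oU C3; apply. Qed.

Lemma C3_diff_derive2 a b u : U u -> differentiable ('D_a ('D_b f)) u.
Proof.
by have [+ _] := Ck_on_derive a oU (Ck_on_derive b oU C3); apply.
Qed.

Lemma C3_derive_sym a b u : U u -> 'D_a ('D_b f) u = 'D_b ('D_a f) u.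
Proof.
move=> Uu; apply: derive_sym; try exact: C3_diff_derive.
by apply: filterS (near_U Uu) => y; exact: C3_diff.
Qed.

Lemma C3_derive3_swap a b c u : U u ->
  'D_a ('D_b ('D_c f)) u = 'D_b ('D_a ('D_c f)) u.
Proof.
move=> Uu; apply: derive_sym; try exact: C3_diff_derive2.
by apply: filterS (near_U Uu) => y; exact: C3_diff_derive.
Qed.

(** Exchange the inner two derivatives on all of [U], then the outer two at [u]. This brings the
    last argument of the Cartan tensor outermost, where it becomes the direction in which g is
    differentiated. *)
Lemma C3_derive3_rot a b c u : U u ->
  'D_a ('D_b ('D_c f)) u = 'D_c ('D_a ('D_b f)) u.
Proof.
move=> Uu.
have inner : 'D_a ('D_b ('D_c f)) u = 'D_a ('D_c ('D_b f)) u.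
  apply: near_eq_derive; apply: filterS (near_U Uu) => y; exact: C3_derive_sym.
(* Rewriting would diverge, unfolding derivatives taken in different orders. *)
exact (etrans inner (C3_derive3_swap a c b Uu)).
Qed.

Lemma fund_tensor_sym u a b : U u -> fund_tensor f u a b = fund_tensor f u b a.
Proof. by move=> Uu; rewrite !fund_tensorE C3_derive_sym. Qed.

(** The first argument enters through the differential of ['D_c f], which is linear. *)
Lemma fund_tensor_linl k a b c u : U u ->
  fund_tensor f u (k *: a + b) c =
    k * fund_tensor f u a c + fund_tensor f u b c.
Proof.
move=> Uu; rewrite !fund_tensorE !deriveE; try exact: C3_diff_derive.
by rewrite linearP /= mulrDr mulrCA.
Qed.

Lemma fund_tensor_linr k a b c u : U u ->
  fund_tensor f u c (k *: a + b) =
    k * fund_tensor f u c a + fund_tensor f u c b.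
Proof. by move=> Uu; rewrite !(fund_tensor_sym c)// fund_tensor_linl. Qed.

Lemma cartan_tensor_swap a b c u : U u ->
  cartan_tensor f u a b c = cartan_tensor f u b a c.
Proof.
move=> Uu; rewrite !cartan_tensorE.
exact (congr1 (fun y => 4^-1 * y) (C3_derive3_swap a b c Uu)).
Qed.

(** The factor 2 of the theorem arises here: g carries 1/2 before a second derivative and C carries
    1/4 before a third. *)
Lemma is_derive_fund_tensor a b h u : U u ->
  is_derive u h (fun u => fund_tensor f u a b)
    (2 * cartan_tensor f u a b h).
Proof.
move=> Uu.
have -> : 2 * cartan_tensor f u a b h = 2^-1 *: 'D_h ('D_a ('D_b f)) u.
  have q (y : R) : 2 * (4^-1 * y) = 2^-1 * y by field.
  rewrite cartan_tensorE.
  exact (etrans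
    (congr1 (fun y => 2 * (4^-1 * y)) (C3_derive3_rot a b h Uu)) (q _)).
have -> : (fun u => fund_tensor f u a b) = 2^-1 *: ('D_a ('D_b f)).
  by apply/funext => w; rewrite fund_tensorE.
by apply: is_deriveZ; apply/derivableP/diff_derivable/C3_diff_derive2.
Qed.

End Hessian.

(** * The vertical projection in one tangent space and its derivative *)

Section VerticalProjection.
Variables (R : realType) (n k : nat) (U : set 'rV[R]_n) (f : 'rV[R]_n -> R).
Hypotheses (oU : open U) (C3 : Ck_on 3 U f).
Variables (K : 'M[R]_(k, n)).
Hypotheses (freeK : row_free K).
Let W : set 'rV[R]_n := [set w | (w <= K)%MS].

Definition fund_mx (u : 'rV[R]_n) : 'M[R]_n :=
  \matrix_(i, j) fund_tensor f u (delta_mx 0 i) (delta_mx 0 j).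

Lemma fund_mxE u a b : U u ->
  fund_tensor f u a b = (a *m fund_mx u *m b^T) 0 0.
Proof.
move=> Uu; rewrite (bilinear_mxE (g := fund_tensor f u)); last 2 first.
- by move=> *; rewrite (fund_tensor_linl oU C3).
- by move=> *; rewrite (fund_tensor_linr oU C3).
rewrite -mulmxA mxE; apply: eq_bigr => i _; rewrite mxE; congr (_ * _).
by apply: eq_bigr => j _; rewrite !mxE mulrC.
Qed.

Lemma fund_mx_unit u : U u -> nondegenerate_on f u setT -> fund_mx u \in unitmx.
Proof.
move=> Uu nd; rewrite -row_free_unit -kermx_eq0; apply/rowV0P => x.
move=> /sub_kermxP xG; apply: nd => // h _.
by rewrite fund_mxE// xG mul0mx mxE.
Qed.

(** The difference of two candidates is orthogonal to every vector, so non-degeneracy determines the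
    choice made by [xget]. *)
Lemma cartan_sharp_eq u x h (y : 'rV[R]_n) : U u -> nondegenerate_on f u setT ->
  (forall b, fund_tensor f u b y = cartan_tensor f u b x h) ->
  cartan_sharp f u x h = y.
Proof.
move=> Uu nd yE.
have uniq (z : 'rV[R]_n) :
    (forall b, fund_tensor f u b z = cartan_tensor f u b x h) -> z = y.
  move=> zE; apply: subr0_eq; apply: (nd (z - y) I) => b _.
  have -> : z - y = (-1) *: y + z by rewrite scaleN1r addrC.
  rewrite (fund_tensor_linl oU C3)// !(fund_tensor_sym oU C3 _ b)// zE yE.
  by rewrite mulN1r addNr.
exact: (xget_unique 0 yE uniq).
Qed.

Definition gram_mx (u : 'rV[R]_n) : 'M[R]_k := K *m fund_mx u *m K^T.

(** If x annihilates the Gram matrix from the left, then x K lies in [W] and is orthogonal to [W],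
    hence vanishes; as the rows of [K] are free, x = 0. *)
Lemma gram_mx_unit u : U u -> nondegenerate_on f u W -> gram_mx u \in unitmx.
Proof.
move=> Uu nd; rewrite -row_free_unit -kermx_eq0; apply/rowV0P => x.
move=> /sub_kermxP xG; apply: (row_free_inj freeK); rewrite mul0mx.
apply: nd => [|h /submxP[d ->]]; first exact: submxMl.
rewrite fund_mxE// trmx_mul -!mulmxA (mulmxA K) (mulmxA (K *m _)).
by rewrite -/(gram_mx u) mulmxA xG mul0mx mxE.
Qed.

(** The difference of two candidates lies in [W] and, being also a difference of two horizontal
    vectors, is orthogonal to [W]. *)
Lemma vpart_eq u e y : U u -> nondegenerate_on f u W ->
  W y -> g_horizontal f u W (e - y) -> vpart f u W e = y.
Proof.
move=> Uu nd Wy hy; apply: xget_unique; first by split.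
move=> z [Wz hz]; apply/subr0_eq/nd => [|w Ww].
  by rewrite /W /= addmx_sub// eqmx_opp.
have -> : z - y = (-1) *: (e - z) + (e - y).
  by rewrite scaleN1r opprB addrA subrK.
by rewrite (fund_tensor_linl oU C3)// hz// hy// mulr0 addr0.
Qed.

(** Orthogonality of e - c K to the rows of [K] reads c (K G K^T) = e G K^T, which the inverse Gram
    matrix solves for c. *)
Lemma vpart_mxE u e : U u -> nondegenerate_on f u W ->
  vpart f u W e = e *m fund_mx u *m K^T *m invmx (gram_mx u) *m K.
Proof.
move=> Uu nd; have uN := gram_mx_unit Uu nd.
apply: vpart_eq => // [|w /submxP[d ->]]; first exact: submxMl.
rewrite fund_mxE// trmx_mul mulmxA !mulmxBl.
rewrite -!mulmxA (mulmxA K) (mulmxA (K *m _)).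
by rewrite -/(gram_mx u) mulKmx// subrr mxE.
Qed.

Lemma vpart_id u w : U u -> nondegenerate_on f u W -> W w -> vpart f u W w = w.
Proof.
move=> Uu nd Ww; apply: vpart_eq => // w' _.
by rewrite fund_mxE// subrr !mul0mx mxE.
Qed.

Lemma hpart_id u x : U u -> nondegenerate_on f u W -> g_horizontal f u W x ->
  hpart f u W x = x.
Proof.
move=> Uu nd hx; rewrite /hpart (@vpart_eq u x 0) ?subr0//.
by rewrite /W /= sub0mx.
Qed.

Lemma is_derive_fund_mx u h : U u ->
  is_derive u h fund_mx
    (\matrix_(i, j) (2 * cartan_tensor f u (delta_mx 0 i) (delta_mx 0 j) h)).
Proof.
move=> Uu; apply/is_derive_mxP => i j; rewrite mxE.
rewrite (_ : (fun _ => _) =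
  (fun u => fund_tensor f u (delta_mx 0 i) (delta_mx 0 j))); last first.
  by apply/funext => w; rewrite mxE.
exact: (is_derive_fund_tensor oU C3).
Qed.

Hypothesis ndW : forall u, U u -> nondegenerate_on f u W.

Lemma is_derive_vpart u e h : U u -> nondegenerate_on f u setT ->
  is_derive u h (fun u => vpart f u W e)
    (2 *: vpart f u W (cartan_sharp f u (hpart f u W e) h)).
Proof.
move=> Uu nd; pose G := fund_mx; pose N := gram_mx.
have nU : \forall y \near u, U y by exact: open_nbhs_nbhs.
(* The entries of [dG] stay hidden; the Cartan tensor comes back only through [gE]. *)
have [dG dGu] : exists dG, is_derive u h G dG.
  by eexists; exact: is_derive_fund_mx.
have dN : is_derive u h N (K *m dG *m K^T).
  exact: is_derive_mulmxr (is_derive_mulmxl K dGu).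
have deG : is_derive u h (fun u => e *m G u *m K^T) (e *m dG *m K^T).
  exact: is_derive_mulmxr (is_derive_mulmxl e dGu).
have uN : N u \in unitmx by apply: gram_mx_unit => //; exact: ndW.
have nN : \forall y \near u, N y \in unitmx.
  by apply: filterS nU => y Uy; apply: gram_mx_unit => //; exact: ndW.
have /derivableP diN : derivable (fun u => invmx (N u)) u h.
  by apply: derivable_invmx => //; have [] := dN.
pose c y := e *m G y *m K^T *m invmx (N y).
(* Only the existence of this derivative is taken from the product rule. Its value comes from
   differentiating c N = e G K^T, so the derivative of the inverse is never computed. *)
have [dc dcu] : exists dc, is_derive u h c dc.
  by eexists; exact: is_derive_mulmx deG diN.
have Ec : dc = (e - c u *m K) *m dG *m K^T *m invmx (N u).
  have E1 := is_derive_mulmx dcu dN.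
  have E2 : is_derive u h (fun y => c y *m N y) (e *m dG *m K^T).
    apply: near_eq_is_derive deG; apply: filterS nN => y uy.
    by rewrite /c mulmxKV.
  move: E1 => [_]; have [_ ->] := E2 => E.
  apply: (can_inj (mulmxK uN)); rewrite mulmxKV//.
  by rewrite !mulmxBl E !mulmxA addrK.
have xE : e - c u *m K = hpart f u W e.
  by rewrite /hpart vpart_mxE//; exact: ndW.
set x := hpart f u W e in xE *.
have sharpE : 2 *: cartan_sharp f u x h = x *m dG *m invmx (G u).
  (* The vector [x] is the horizontal part at the base point and stays fixed while the metric
     varies; both sides differentiate [fund_tensor f y x b] in y at [u]. *)
  have gE b : 2 * cartan_tensor f u x b h = (x *m dG *m b^T) 0 0.
    have /is_derive_mxP/(_ 0 0) :=
      is_derive_mulmxr b^T (is_derive_mulmxl x dGu).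
    have [_ <-] := is_derive_fund_tensor oU C3 x b h Uu.
    move=> [_ <-]; apply: near_eq_derive; apply: filterS nU => y Uy.
    exact: fund_mxE.
  have uG := fund_mx_unit Uu nd.
  pose y := 2^-1 *: (x *m dG *m invmx (G u)).
  have yE b : fund_tensor f u y b = cartan_tensor f u x b h.
    rewrite fund_mxE// /y -!scalemxAl mxE mulmxKV// -gE.
    by field.
  rewrite (@cartan_sharp_eq u x h y Uu nd) => [|b].
    by rewrite scalerA divff ?scale1r// pnatr_eq0.
  (* In [cartan_sharp] the test vector [b] comes first in both tensors, whereas [yE] has it
     second. *)
  exact (etrans (fund_tensor_sym oU C3 b y Uu)
    (etrans (yE b) (cartan_tensor_swap oU C3 x b h Uu))).
have dy : is_derive u h (fun y => c y *m K) (dc *m K).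
  exact: is_derive_mulmxr dcu.
(* Applying the projection formula to the vector of [sharpE], G^-1 cancels against G and leaves x G'
   K^T N^-1 K, which is [dc *m K] by [Ec]. *)
rewrite vpart_mxE//; last exact: ndW.
rewrite !scalemxAl sharpE.
rewrite mulmxKV ?fund_mx_unit// -xE -Ec.
apply: near_eq_is_derive dy; apply: filterS nU => y Uy.
by rewrite vpart_mxE//; exact: ndW.
Qed.

End VerticalProjection.

(** * From the manifold to a single tangent space *)

(** Tangent vectors at [p] are given by components in the preferred chart, so there [tvec] is the
    identity. As [para c (coord c p)] is only provably equal to [p], this is phrased through a
    family [Phi] over the points, later [A] or [L]. *)
Lemma tvec_chart_at (R : realType) (n : nat) (M : manifold R n) (T : Type)
    (Phi : forall q : M, tangent q -> T) (p : M) (xi : tangent p)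
    (c := chart_at p) :
  Phi (para c (Defs.coord c p)) (tvec c (Defs.coord c p) xi) = Phi p xi.
Proof.
have domp : dom c p := chart_at_dom p.
have E : 'd (Defs.coord c \o para c) (Defs.coord c p) xi = xi.
  have idc : {near Defs.coord c p, @idfun 'rV[R]_n =1 Defs.coord c \o para c}.
    have : nbhs (Defs.coord c p) (Defs.coord c @` dom c).
      by apply: open_nbhs_nbhs; split; [exact: img_open|exists p].
    by apply: filterS => x [q cq <-] /=; rewrite coordK.
  have [did _] := is_diff_id (Defs.coord c p).
  have [_ ->] := near_eq_is_diff idc did.
  by rewrite diff_val.
(* The base point is generalized to [q], so that eliminating its equality with [p] changes the
   preferred chart along with it. *)
rewrite /tvec; move: (coordK domp); set q := para c _ => qp.
by case: _ / (esym qp); rewrite E.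
Qed.

Lemma tdom_slice (R : realType) (n : nat) (M : manifold R n)
    (A : forall p : M, set (tangent p)) (p : M) (c := chart_at p) :
  [set xi | tdom A c (Defs.coord c p, xi)] = A p :> set 'rV[R]_n.
Proof.
apply/funext => xi; apply/propext; rewrite /tdom /= (tvec_chart_at A xi).
split=> [[]//|Axi]; split=> //; exists p => //; exact: chart_at_dom.
Qed.

Lemma pseudo_finsler_open (R : realType) (n : nat) (M : manifold R n)
    (A : forall p : M, set (tangent p)) (L : forall p : M, tangent p -> R)
    (hL : pseudo_finsler A L) (p : M) :
  open (A p : set 'rV[R]_n).
Proof.
rewrite -tdom_slice; apply: open_slice.
exact: pf_open hL _ (chart_at_atlas p).
Qed.

Lemma pseudo_finsler_Ck (R : realType) (n : nat) (M : manifold R n)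
    (A : forall p : M, set (tangent p)) (L : forall p : M, tangent p -> R)
    (hL : pseudo_finsler A L) (k : nat) (p : M) :
  Ck_on k (A p : set 'rV[R]_n) (L p : 'rV[R]_n -> R).
Proof.
have := pf_smooth hL (chart_at_atlas p) k.
have oA := pf_open hL (chart_at_atlas p).
move=> /(Ck_on_slice (Defs.coord (chart_at p) p) oA); rewrite tdom_slice.
apply: Ck_on_eq; first exact: (pseudo_finsler_open (p := p) hL).
by move=> xi _; rewrite /= (tvec_chart_at L xi).
Qed.

(** The rows of [kermx] span the kernel but may be dependent; [row_base] extracts a basis, which
    makes the Gram matrix invertible. *)
Definition vertical_mx (R : realType) (n m : nat) (M : manifold R n)
    (B : manifold R m) (sigma : M -> B) (p : M) :=
  row_base (kermx (lin1_mx (dmap sigma p : 'rV[R]_n -> 'rV[R]_m))).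

Lemma verticalE (R : realType) (n m : nat) (M : manifold R n)
    (B : manifold R m) (sigma : M -> B) (p : M) :
  vertical sigma p = [set w : 'rV[R]_n | (w <= vertical_mx sigma p)%MS].
Proof.
apply/funext => w; apply/propext; rewrite /vertical /= eq_row_base.
pose phi : {linear 'rV[R]_n -> 'rV[R]_m} :=
  'd (Defs.coord (chart_at (sigma p)) \o sigma \o para (chart_at p))
     (Defs.coord (chart_at p) p).
have E : w *m lin1_mx phi = dmap sigma p w by rewrite mul_rV_lin1.
by rewrite -E; split=> [/sub_kermxP|/sub_kermxP].
Qed.

Theorem proposition1 (R : realType) (n m : nat)
    (M : manifold R n) (A : forall p : M, set (tangent p))
    (L : forall p : M, tangent p -> R)
    (B : manifold R m) (A' : forall q : B, set (tangent q))
    (L' : forall q : B, tangent q -> R) (sigma : M -> B)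
    (hL : pseudo_finsler A L) (hL' : pseudo_finsler A' L')
    (hsigma : pseudo_finsler_submersion A L A' L' sigma)
    (hvert : forall (p : M) (v : tangent p), A p v ->
       nondegenerate_on (L p) v (vertical sigma p))
    (p : M) (v : tangent p) (hv : A p v) :
  let W := vertical sigma p in
  let top (e u : tangent p) := vpart (L p) u W e in
  let bot (e u : tangent p) := hpart (L p) u W e in
  [/\ forall w : tangent p, W w -> forall h : tangent p,
        is_derive v h (top w) 0 /\ is_derive v h (bot w) 0,
      forall x : tangent p, g_horizontal (L p) v W x -> forall h : tangent p,
        is_derive v h (top x) (2 *: top (cartan_sharp (L p) v x h) v) /\
        is_derive v h (bot x) (- 2 *: top (cartan_sharp (L p) v x h) v) &
      forall e h : tangent p,
        is_derive v h (top e)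
          (2 *: top (cartan_sharp (L p) v (bot e v) h) v) /\
        is_derive v h (bot e)
          (- 2 *: top (cartan_sharp (L p) v (bot e v) h) v)].
Proof.
move=> W top bot.
have oA := pseudo_finsler_open (p := p) hL; have CA := pseudo_finsler_Ck hL 3 p.
have freeK : row_free (vertical_mx sigma p) by exact: row_base_free.
have WE : W = _ := verticalE sigma p.
have ndW u : A p u -> nondegenerate_on (L p) u W by exact: hvert.
have ndT := pf_nondeg hL hv.
have nA : \forall y \near v, A p y by exact: open_nbhs_nbhs.
rewrite {}/top {}/bot; rewrite {}WE in ndW *.
have D3 e h := is_derive_vpart oA CA freeK ndW e h hv ndT.
(* The horizontal part is the constant [e] minus the vertical part. *)
have D3' e h : is_derive v h (fun u => hpart (L p) u _ e) _ :=
  is_deriveB (is_derive_cst e v h) (D3 e h).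
split.
(* The vertical space does not depend on u, so w is its own vertical part at every admissible u, and
   these fill a neighbourhood of v. *)
- move=> w Ww h; split.
    apply: near_eq_is_derive (is_derive_cst w v h).
    apply: filterS nA => u Au /=; apply/esym.
    exact: (vpart_id oA CA Au (ndW _ Au) Ww).
  apply: near_eq_is_derive (is_derive_cst 0 v h).
  apply: filterS nA => u Au /=; rewrite /hpart.
  by rewrite (vpart_id oA CA Au (ndW _ Au) Ww) subrr.
(* Here x is horizontal at v only, so its parts may vary with u; the general formula applies, with x
   as its own horizontal part at v. *)
- move=> x hx h; have := D3 x h; have := D3' x h.
  rewrite (hpart_id oA CA hv (ndW _ hv) hx) sub0r -scaleNr.
  by move=> d2 d1; split.
- move=> e h; split; first exact: D3.
  by have := D3' e h; rewrite sub0r -scaleNr.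
Qed.
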